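(* Let $\mathcal D(P_n)$ be the ring of differential operators with polynomial coefficients $P_n=K[x_1,\dots,x_n]$ over a field $K$ of characteristic $p>0$. Then $\mathrm{d}(\mathcal D(P_n))=1$ for each $\mathrm{d}=\mathrm{fd},\mathrm{lfd},\mathrm{ud},\mathrm{lud}$ (the dimensions being taken with respect to the canonical filtration $F$).
   Context: $n\ge1$; $\mathcal D(P_n)$ is the ring of $K$-linear differential operators on $P_n$; it is a simple algebra. For $k\ge0$ let $\partial_i^{[k]}=\frac{\partial_i^k}{k!}$ be the $K$-linear operator $x^\alpha\mapsto\binom{\alpha_i}{k}x^{\alpha-ke_i}$ (zero if $k>\alpha_i$), and $\partial^{[\beta]}=\prod_i\partial_i^{[\beta_i]}$. Then $\mathcal D(P_n)=\bigoplus_{\alpha,\beta\in\mathbb N^n}Kx^\alpha\partial^{[\beta]}$. The canonical filtration is $F=\{F_i\}_{i\ge0}$, $F_i=\bigoplus_{|\alpha|+|\beta|\le i}Kx^\alpha\partial^{[\beta]}$. For $f:\mathbb N\to\mathbb N$, $\gamma(f):=\inf\{r\ge0: f(i)\le i^r\text{ for }i\gg0\}$. For a simple algebra $A$ with a finite dimensional filtration $F=\{A_i\}$ and group of units $U(A)$ define (with $XaY$ the linear span of the elements $xay$, $x\in X$, $y\in Y$): $\nu_F(i):=\min\{j : 1\in A_jaA_j \ \forall\, 0\ne a\in A_i\}$, $\lambda_F(i):=\min\{j : 1\in AaA_j\ \forall\, 0\neq a\in A_i\}$, $\nu^u_F(i):=\min\{j : U(A)\cap A_jaA_j\ne\emptyset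 \ \forall\, 0\ne a\in A_i\}$, $\lambda^u_F(i):=\min\{j : U(A)\cap AaA_j\ne\emptyset \ \forall\, 0\ne a\in A_i\}$. Then $\mathrm{fd}(A)=\gamma(\nu_F)$, $\mathrm{lfd}(A)=\gamma(\lambda_F)$, $\mathrm{ud}(A)=\gamma(\nu_F^u)$, $\mathrm{lud}(A)=\gamma(\lambda_F^u)$. Here $A=\mathcal D(P_n)$, $A_i=F_i$. *)

(* Defs.v *)
From HB Require Import structures.
From mathcomp Require Import all_boot all_order all_algebra.
(* mpoly must come before MathComp-Analysis: importing it afterwards fails on
   conflicting notation levels. *)
From mathcomp Require Import ssrcomplements mpoly.
From mathcomp Require Import boolp classical_sets reals constructive_ereal ereal.
From mathcomp Require Import topology sequences exp.

Set Implicit Arguments.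
Unset Strict Implicit.
Unset Printing Implicit Defensive.

Import Order.TTheory GRing.Theory Num.Theory.

Local Open Scope classical_set_scope.
Local Open Scope ring_scope.

(* End_K(P_n) as a K-algebra; the alias [endo] carries composition as its
   product. *)
Section Endomorphisms.
Context (K : fieldType) (n : nat).
Local Notation P := {mpoly K[n]}.

Definition endo : Type := {linear P -> P}.

HB.instance Definition _ := gen_eqMixin endo.
HB.instance Definition _ := gen_choiceMixin endo.

Definition endo_fun (u : endo) : P -> P := (u : {linear P -> P}).
Coercion endo_fun : endo >-> Funclass.

HB.instance Definition _ (u : endo) :=
  GRing.Linear.copy (endo_fun u) (u : {linear P -> P}).

Lemma endoP (u v : endo) : (forall f, u f = v f) -> u = v.
Proof.
case: u v => u [[ua] [us]] [v [[va] [vs]]] uv.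
have {}uv : u = v by apply/funext => f; exact: uv.
subst v; rewrite (Prop_irrelevance ua va) (Prop_irrelevance us vs); reflexivity.
Qed.

Definition endo0 : endo := (\0 : {linear P -> P}).
Definition endo1 : endo := (idfun : {linear P -> P}).
Definition endo_opp (u : endo) : endo := (\- u : {linear P -> P}).
Definition endo_add (u v : endo) : endo := (u \+ v : {linear P -> P}).
Definition endo_scale (c : K) (u : endo) : endo := (c \*: u : {linear P -> P}).
Definition endo_mul (u v : endo) : endo := (u \o v : {linear P -> P}).

Fact endo_addA : associative endo_add.
Proof. by move=> u v w; apply: endoP => f; exact: addrA. Qed.
Fact endo_addC : commutative endo_add.
Proof. by move=> u v; apply: endoP => f; exact: addrC. Qed.
Fact endo_add0 : left_id endo0 endo_add.
Proof. by move=> u; apply: endoP => f; exact: add0r. Qed.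
Fact endo_addN : left_inverse endo0 endo_opp endo_add.
Proof. by move=> u; apply: endoP => f; exact: addNr. Qed.

HB.instance Definition _ :=
  GRing.isZmodule.Build endo endo_addA endo_addC endo_add0 endo_addN.

Fact endo_mulA : associative endo_mul.
Proof. by move=> u v w; apply: endoP. Qed.
Fact endo_mul1l : left_id endo1 endo_mul.
Proof. by move=> u; apply: endoP. Qed.
Fact endo_mul1r : right_id endo1 endo_mul.
Proof. by move=> u; apply: endoP. Qed.
Fact endo_mulDl : left_distributive endo_mul +%R.
Proof. by move=> u v w; apply: endoP. Qed.
Fact endo_mulDr : right_distributive endo_mul +%R.
Proof. by move=> u v w; apply: endoP => f; exact: (linearD u). Qed.
Fact endo_oner_neq0 : endo1 != 0.
Proof.
apply/eqP => /(congr1 (fun u : endo => u 1)) e.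
have {}e : (1 : P) = 0 by exact: e.
by move/eqP: (oner_neq0 P).
Qed.

HB.instance Definition _ := GRing.Zmodule_isNzRing.Build endo
  endo_mulA endo_mul1l endo_mul1r endo_mulDl endo_mulDr endo_oner_neq0.

Fact endo_scaleA (a b : K) (u : endo) :
  endo_scale a (endo_scale b u) = endo_scale (a * b) u.
Proof. by apply: endoP => f; exact: scalerA. Qed.
Fact endo_scale1 : left_id 1 endo_scale.
Proof. by move=> u; apply: endoP => f; exact: scale1r. Qed.
Fact endo_scaleDr : right_distributive endo_scale +%R.
Proof. by move=> c u v; apply: endoP => f; exact: scalerDr. Qed.
Fact endo_scaleDl (u : endo) : {morph endo_scale^~ u : a b / a + b}.
Proof. by move=> a b; apply: endoP => f; exact: scalerDl. Qed.

HB.instance Definition _ := GRing.Zmodule_isLmodule.Build K endo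
  endo_scaleA endo_scale1 endo_scaleDr endo_scaleDl.

Fact endo_scaleAl (a : K) (u v : endo) : a *: (u * v) = (a *: u) * v.
Proof. by apply: endoP. Qed.
HB.instance Definition _ := GRing.Lmodule_isLalgebra.Build K endo endo_scaleAl.

Fact endo_scaleAr (a : K) (u v : endo) : a *: (u * v) = u * (a *: v).
Proof. by apply: endoP => f; symmetry; exact: (linearZZ u). Qed.
HB.instance Definition _ := GRing.Lalgebra_isAlgebra.Build K endo endo_scaleAr.

End Endomorphisms.

Section DifferentialOperators.
Context (K : fieldType) (n : nat).
Local Notation P := {mpoly K[n]}.
Local Notation E := (endo K n).

Definition mulop_fun (f g : P) : P := f * g.

Fact mulop_is_linear (f : P) : linear (mulop_fun f).
Proof. by move=> c g h; rewrite /mulop_fun mulrDr scalerAr. Qed.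
HB.instance Definition _ (f : P) :=
  GRing.isLinear.Build K P P _ (mulop_fun f) (mulop_is_linear f).

Definition mulop (f : P) : E := (mulop_fun f : {linear P -> P}).

(* Grothendieck's differential operators of order at most k: those whose
   commutators with multiplications have order at most k - 1. *)
Fixpoint diffop_le (k : nat) (u : E) : Prop :=
  match k with
  | 0%N => forall f, u * mulop f - mulop f * u = 0
  | k'.+1 => forall f, diffop_le k' (u * mulop f - mulop f * u)
  end.

Definition is_diffop : {pred E} := fun u => `[< exists k, diffop_le k u >].

Fact diffop_le0 k : diffop_le k 0.
Proof.
by elim: k => [|k IHk] f; rewrite mul0r mulr0 subrr.
Qed.

Fact diffop_leS k u : diffop_le k u -> diffop_le k.+1 u.
Proof.
elim: k u => [|k IHk] u uk f; last exact/IHk/uk.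
by rewrite uk; exact: (diffop_le0 0).
Qed.

Fact diffop_leW k l u : (k <= l)%N -> diffop_le k u -> diffop_le l u.
Proof.
by move=> /subnK <- uk; elim: (l - k)%N => //= m; exact: diffop_leS.
Qed.

Fact diffop_le_linear k c u v :
  diffop_le k u -> diffop_le k v -> diffop_le k (c *: u + v).
Proof.
have bracketE f : (c *: u + v) * mulop f - mulop f * (c *: u + v)
    = c *: (u * mulop f - mulop f * u) + (v * mulop f - mulop f * v).
  by rewrite mulrDl mulrDr -scalerAl -scalerAr opprD addrACA -scalerBr.
elim: k u v bracketE => [|k IHk] u v bracketE uk vk f; rewrite bracketE.
  by rewrite uk vk scaler0 addr0.
apply: IHk => // g.
by rewrite mulrDl mulrDr -scalerAl -scalerAr opprD addrACA -scalerBr.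
Qed.

Fact diffop_leD k u v : diffop_le k u -> diffop_le k v -> diffop_le k (u + v).
Proof. by rewrite -{2}[u]scale1r; exact: diffop_le_linear. Qed.

Fact diffop_leM k l u v :
  diffop_le k u -> diffop_le l v -> diffop_le (k + l) (u * v).
Proof.
have bracketM w z f : w * z * mulop f - mulop f * (w * z)
    = w * (z * mulop f - mulop f * z) + (w * mulop f - mulop f * w) * z.
  by rewrite mulrBr mulrBl !mulrA addrA subrK.
have [m] := ubnP (k + l); elim: m k l u v => // m IHm k l u v klm uk vl.
have left_part f : diffop_le (k + l).-1 (u * (v * mulop f - mulop f * v)).
  case: l => [|l] in klm vl *; first by rewrite vl mulr0; exact: diffop_le0.
  by rewrite addnS; apply: IHm; rewrite -?addnS.
have right_part f : diffop_le (k + l).-1 ((u * mulop f - mulop f * u) * v).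
  clear left_part; case: k => [|k] in klm uk *.
    by rewrite uk mul0r; exact: diffop_le0.
  by rewrite addSn; apply: IHm; rewrite -?addSn.
have [kl0|kl_gt0] := posnP (k + l); last first.
  rewrite -(prednK kl_gt0) /= => f; rewrite bracketM.
  by apply: diffop_leD; [exact: left_part|exact: right_part].
move/eqP: kl0; rewrite addn_eq0 => /andP[/eqP k0 /eqP l0]; subst k l.
by move=> f; rewrite bracketM uk vl mulr0 mul0r addr0.
Qed.

Fact is_diffop_subalg : subalg_closed is_diffop.
Proof.
split=> [|c u v|u v].
- by apply/asboolP; exists 0%N => f; rewrite mul1r mulr1 subrr.
- move=> /asboolP[k uk] /asboolP[l vl]; apply/asboolP; exists (maxn k l).
  apply: diffop_le_linear; first by apply: diffop_leW uk; exact: leq_maxl.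
  by apply: diffop_leW vl; exact: leq_maxr.
- move=> /asboolP[k uk] /asboolP[l vl]; apply/asboolP; exists (k + l)%N.
  exact: diffop_leM.
Qed.

HB.instance Definition _ :=
  GRing.isSubalgClosed.Build K E is_diffop is_diffop_subalg.

Record diffop := Diffop { diffop_val : E; _ : diffop_val \in is_diffop }.

HB.instance Definition _ := [isSub for diffop_val].
HB.instance Definition _ := [Choice of diffop by <:].
HB.instance Definition _ := [SubChoice_isSubAlgebra of diffop by <:].

End DifferentialOperators.

Definition lin_span (K : fieldType) (A : lmodType K) (S : set A) : set A :=
  [set a | exists (m : nat) (c : 'I_m -> K) (s : 'I_m -> A),
     (forall k, S (s k)) /\ a = \sum_(k < m) c k *: s k].

Section CanonicalFiltration.
Context (K : fieldType) (n : nat).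
Local Notation P := {mpoly K[n]}.
Local Notation E := (endo K n).

(* The divided power d_i^k / k!.  When m i < k the binomial coefficient
   vanishes, so the truncated subtraction of exponents is harmless. *)
Definition divpow_fun (i : 'I_n) (k : nat) (f : P) : P :=
  \sum_(m <- msupp f) ('C(m i, k)%:R * f@_m) *: 'X_[m - U_(i) *+ k].

Fact divpow_funwE i k f d : (msize f <= d)%N ->
  divpow_fun i k f =
  \sum_(m : 'X_{1..n < d}) ('C(m i, k)%:R * f@_m) *: 'X_[m - U_(i) *+ k].
Proof.
move=> le_fd; rewrite /divpow_fun (big_mksub 'X_{1..n < d}) /=; first last.
- by move=> x /msize_mdeg_lt/leq_trans/(_ le_fd).
- by rewrite msupp_uniq.
rewrite big_rmcond //= => j /memN_msupp_eq0 ->.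
by rewrite mulr0 scale0r.
Qed.

Fact divpow_is_linear i k : linear (divpow_fun i k).
Proof.
move=> c f g; pose d := maxn (msize f) (maxn (msize g) (msize (c *: f + g))).
rewrite !(@divpow_funwE _ _ _ d) /d ?leq_max ?leqnn ?orbT //.
rewrite scaler_sumr -big_split /=; apply: eq_bigr => m _.
by rewrite mcoeffD mcoeffZ mulrDr mulrCA scalerDl scalerA.
Qed.
HB.instance Definition _ i k :=
  GRing.isLinear.Build K P P _ (divpow_fun i k) (divpow_is_linear i k).

Definition divpow (i : 'I_n) (k : nat) : E :=
  (divpow_fun i k : {linear P -> P}).

Definition mdivpow (b : 'X_{1..n}) : E := \prod_(i < n) divpow i (b i).

(* The operators x^a d^[b] belong to D(P_n); membership in their span is
   tested in End_K(P_n), through the inclusion [val]. *)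
Definition canonical_filtration (i : nat) : set (diffop K n) :=
  [set u | lin_span [set mulop 'X_[ab.1] * mdivpow ab.2
                    | ab in [set ab : 'X_{1..n} * 'X_{1..n}
                            | (mdeg ab.1 + mdeg ab.2 <= i)%N]] (val u)].

End CanonicalFiltration.

Section FilterDimension.
Context (R : realType).
Local Open Scope ereal_scope.

(* Growth functions take values in N, with +oo for the minimum of an empty
   set; such a value is bounded by no power of i. *)
Definition growth (f : nat -> \bar R) : \bar R :=
  ereal_inf [set r%:E | r in [set r : R | (0 <= r)%R /\
    \forall i \near \oo, f i <= (i%:R `^ r)%:E]].

Definition min_nat (S : set nat) : \bar R :=
  ereal_inf [set (j%:R)%:E | j in S].

Context (K : fieldType) (A : algType K) (F : nat -> set A).

Definition sandwich (X : set A) (a : A) (Y : set A) : set A :=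
  lin_span [set (x * a * y)%R | x in X & y in Y].

Definition units : set A :=
  [set u | exists v : A, (u * v = 1)%R /\ (v * u = 1)%R].

Definition nu (i : nat) : \bar R :=
  min_nat [set j | forall a, F i a -> a <> 0%R -> sandwich (F j) a (F j) 1%R].

Definition lambda (i : nat) : \bar R :=
  min_nat [set j | forall a, F i a -> a <> 0%R -> sandwich setT a (F j) 1%R].

Definition nu_u (i : nat) : \bar R :=
  min_nat [set j | forall a, F i a -> a <> 0%R ->
    units `&` sandwich (F j) a (F j) !=set0].

Definition lambda_u (i : nat) : \bar R :=
  min_nat [set j | forall a, F i a -> a <> 0%R ->
    units `&` sandwich setT a (F j) !=set0].

Definition fd : \bar R := growth nu.
Definition lfd : \bar R := growth lambda.
Definition ud : \bar R := growth nu_u.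
Definition lud : \bar R := growth lambda_u.

End FilterDimension.

(* Main.v *)
(* Upper bound.  Let a <> 0 lie in F_i and let q = p^k > i.  The operator a is
   linear over K[x_1^q, ..., x_n^q], so a(x^d) <> 0 for some d with all entries
   less than q, and the degree of a(x^d) is O(q).  After multiplying q by a
   constant power of p, all exponents of a(x^d) are less than q too; if x^g occurs
   in a(x^d) with coefficient c, then the matrix units E_{e,h} of
   End_{K[x^q]}(P_n) satisfy sum_e E_{e,g} a E_{d,e} = c, and they lie in F_{3nq}.
   As q can be taken O(i), this bounds all four functions linearly.

   Lower bound.  The operator a = d_1^[i] kills F_j(1) for j < i, hence every
   element of D a F_j kills 1 and is not a unit. *)
Require Import Defs.
From mathcomp Require Import all_boot all_order all_algebra.
From mathcomp Require Import ssrcomplements mpoly.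
From mathcomp Require Import zify.
From mathcomp Require Import boolp classical_sets reals constructive_ereal ereal.
From mathcomp Require Import topology sequences exp.

Set Implicit Arguments.
Unset Strict Implicit.
Unset Printing Implicit Defensive.

Import Order.TTheory GRing.Theory Num.Theory.

Local Open Scope classical_set_scope.
Local Open Scope ring_scope.

(** * Growth exponents of linearly bounded functions *)

Section GrowthRate.
Context (R : realType).
Implicit Types f g : nat -> \bar R.

(** An exponent [r < 1] is not admissible, since [i ^ r < i] for every [i > 1]; one such [i] beyond
    the threshold suffices. *)
Lemma growth_ge1 f : (forall i, (i%:R)%:E <= f i)%E -> (1 <= growth f)%E.
Proof.
move=> le_f; apply/ereal_infP => _ [r [r_ge0 [N _ le_fr]] <-].
rewrite lee_fin leNgt; apply/negP => r_lt1.
pose i := maxn N 2; have i_gt1 : 1 < i%:R :> R by rewrite ltr1n leq_maxr.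
have := le_trans (le_f i) (le_fr i (leq_maxl _ _)).
rewrite lee_fin -{1}[i%:R]powRr1 ?ler0n // leNgt => /negP; apply.
by rewrite /powR gt_eqF ?(lt_trans ltr01) // ltr_expR ltr_pM2r ?ln_gt0.
Qed.

(** Every exponent [1 + e] with [e > 0] is admissible, because [C <= i ^ e] as soon as [i] reaches
    [C ^ (1/e)]. *)
Lemma growth_le1 (C : nat) f :
  (forall i, (0 < i)%N -> f i <= ((C * i)%:R)%:E)%E -> (growth f <= 1)%E.
Proof.
move=> f_le; apply/lee_addgt0Pr => e e_gt0; apply: ereal_inf_lbound.
exists (1 + e); last by rewrite EFinD.
split; first by rewrite addr_ge0 ?ler01 // ltW.
near=> i.
have i_gt0 : (0 < i)%N by near: i; exists 1%N.
apply: le_trans (f_le i i_gt0) _; rewrite lee_fin.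
have i0 : i%:R != 0 :> R by rewrite pnatr_eq0 -lt0n.
rewrite powRD ?i0 ?implybT // powRr1 ?ler0n // natrM mulrC.
rewrite ler_wpM2l ?ler0n //.
have {1}-> : C%:R = (C%:R `^ e^-1) `^ e :> R.
  by rewrite -powRrM mulVf ?gt_eqF // powRr1 // ler0n.
rewrite ge0_ler_powR ?nnegrE ?powR_ge0 ?ler0n ?(ltW e_gt0) //.
near: i; exact: nbhs_infty_ger.
Unshelve. all: by end_near. Qed.

Lemma min_nat_ge k (S : set nat) :
  (forall j, S j -> (k <= j)%N) -> ((k%:R)%:E <= min_nat R S)%E.
Proof.
by move=> S_ge; apply/ereal_infP => _ [j Sj <-]; rewrite lee_fin ler_nat S_ge.
Qed.

Lemma min_nat_le k (S : set nat) : S k -> (min_nat R S <= (k%:R)%:E)%E.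
Proof. by move=> Sk; apply: ereal_inf_lbound; exists k. Qed.

Lemma growth_min_nat (C : nat) (S : nat -> set nat) :
    (forall i, (0 < i)%N -> S i (C * i)%N) ->
    (forall i j, S i j -> (i <= j)%N) ->
  growth (fun i => min_nat R (S i)) = 1%:E.
Proof.
move=> SC S_ge; apply/eqP; rewrite eq_le; apply/andP; split.
  by apply: (@growth_le1 C) => i i_gt0; apply/min_nat_le/SC.
by apply: growth_ge1 => i; apply/min_nat_ge/S_ge.
Qed.

End GrowthRate.

(** * Binomial coefficients in characteristic [p] *)

Section Binomials.
Context (K : fieldType) (p : nat) (p_char : p \in [pchar K]).
Local Notation q k := (p ^ k)%N.

Let p_pr : prime p. Proof. exact: pcharf_prime p_char. Qed.

(** With [q = p ^ k], the identity [b C(sq, b) = sq C(sq - 1, b - 1)] would force [q] to divide [b]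
    if [p] did not divide [C(sq, b)]. *)
Lemma bin_pfactor_eq0 k s b : (0 < b < q k)%N ->
  'C(s * q k, b)%:R = 0 :> K.
Proof.
case: b => // b /= lt_bq; apply/eqP; rewrite -(dvdn_pcharf p_char).
apply: contraLR lt_bq; rewrite -prime_coprime // -leqNgt => cop.
apply: dvdn_leq => //; rewrite -(Gauss_dvdl _ (coprimeXl k cop)).
by rewrite -mul_bin_diag -mulnA mulnCA dvdn_mulr.
Qed.

(** In the Vandermonde convolution only the term with [C(s * q k, 0)] survives. *)
Lemma bin_addl_pfactor k s m b : (b < q k)%N ->
  'C(s * q k + m, b)%:R = 'C(m, b)%:R :> K.
Proof.
move=> lt_bq; rewrite -binomial.Vandermonde natr_sum big_ord_recl /=.
rewrite bin0 mul1n subn0 big1 ?addr0 // => i _.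
rewrite natrM bin_pfactor_eq0 ?mul0r //.
exact: leq_ltn_trans (ltn_ord i) lt_bq.
Qed.

(** Only the residue of [t] modulo [q k] counts, and a number below [q k] has a nonzero binomial
    over [q k - 1] only if it equals [q k - 1]. This lets a divided power detect residue classes of
    exponents. *)
Lemma bin_pred_pfactor k t : 'C(t, (q k).-1)%:R = (q k %| t.+1)%:R :> K.
Proof.
have q_gt0 : (0 < q k)%N by rewrite expn_gt0 prime_gt0.
rewrite {1}(divn_eq t (q k)) bin_addl_pfactor ?prednK //.
have lt_tq := ltn_pmod t q_gt0.
rewrite {2}(divn_eq t (q k)) -addnS dvdn_addr ?dvdn_mull //.
have [tq|ntq] := eqVneq (t %% q k)%N (q k).-1.
  by rewrite tq binn prednK // dvdnn.
rewrite bin_small; last by rewrite ltn_neqAle ntq -ltnS prednK.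
rewrite gtnNdvd // ltn_neqAle lt_tq andbT.
by apply: contraNneq ntq => /(congr1 predn) <-.
Qed.

End Binomials.

(** * Linear spans *)

Section LinearSpan.
Context (K : fieldType) (V : lmodType K) (S : set V).

Lemma lin_span_ind (Q : V -> Prop) :
    Q 0 -> (forall c u v, S u -> Q v -> Q (c *: u + v)) ->
  forall u, lin_span S u -> Q u.
Proof.
move=> Q0 QS _ [m [c [s [Ss ->]]]].
by apply: big_rec => // k v _; exact: QS.
Qed.

Lemma lin_span0 : lin_span S 0.
Proof. by exists 0%N, (fun=> 0), (fun=> 0); split=> [[]|] //; rewrite big_ord0. Qed.

Lemma lin_span_cons c u v : S u -> lin_span S v -> lin_span S (c *: u + v).
Proof.
move=> Su [m [d [s [Ss ->]]]].
(* Index 0 carries the new term; [unlift ord0] shifts the others back to the old family. *)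
exists m.+1, (fun k => oapp d c (unlift ord0 k)),
  (fun k => oapp s u (unlift ord0 k)).
split=> [k|]; first by case: (unlift ord0 k) => /=.
rewrite big_ord_recl unlift_none /=; congr (_ + _).
by apply: eq_bigr => k _; rewrite liftK.
Qed.

Lemma lin_span_incl u : S u -> lin_span S u.
Proof. by move=> /lin_span_cons-/(_ 1 _ lin_span0); rewrite scale1r addr0. Qed.

Lemma lin_spanD u v : lin_span S u -> lin_span S v -> lin_span S (u + v).
Proof.
move=> Su Sv; move: u Su; apply: lin_span_ind => [|c w u Sw].
  by rewrite add0r.
by rewrite -addrA; exact: lin_span_cons.
Qed.

Lemma lin_spanZ c u : lin_span S u -> lin_span S (c *: u).
Proof.
move: u; apply: lin_span_ind; first by rewrite scaler0; exact: lin_span0.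
by move=> d u v Su Sv; rewrite scalerDr scalerA; exact: lin_span_cons.
Qed.

Lemma lin_span_sum (I : finType) (F : I -> V) :
  (forall i, lin_span S (F i)) -> lin_span S (\sum_i F i).
Proof.
by move=> SF; elim/big_ind: _ => // [|u v]; [exact: lin_span0|exact: lin_spanD].
Qed.

End LinearSpan.

Lemma sub_lin_span (K : fieldType) (V : lmodType K) (S T : set V) :
  S `<=` T -> lin_span S `<=` lin_span T.
Proof.
by move=> ST _ [m [c [s [Ss ->]]]]; exists m, c, s; split=> // k; exact/ST/Ss.
Qed.

(** * Action of the operators on monomials *)

Section MonomialAction.
Context (K : fieldType) (n : nat).
Local Notation P := {mpoly K[n]}.
Local Notation E := (endo K n).
Implicit Types (a b c m : 'X_{1..n}) (u v : E).

Lemma endoZ u (x : K) (f : P) : u (x *: f) = x *: u f.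
Proof. exact: (linearZZ u). Qed.

Lemma endoD u (f g : P) : u (f + g) = u f + u g.
Proof. exact: (linearD u). Qed.

Lemma endo0 u : u 0 = 0.
Proof. exact: (linear0 u). Qed.

Lemma endo_sum u (I : Type) (r : seq I) (F : I -> P) :
  u (\sum_(i <- r) F i) = \sum_(i <- r) u (F i).
Proof. exact: (linear_sum u). Qed.

Lemma endo_eq_monomial u v : (forall m, u 'X_[m] = v 'X_[m]) -> u = v.
Proof.
move=> uv; apply: endoP => f; rewrite [f]mpolyE !endo_sum.
by apply: eq_bigr => m _; rewrite !endoZ uv.
Qed.

Lemma endo_addE u v (f : P) : (u + v : E) f = u f + v f. Proof. by []. Qed.
Lemma endo_scaleE (x : K) u (f : P) : (x *: u : E) f = x *: u f. Proof. by []. Qed.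
Lemma endo_mulE u v (f : P) : (u * v : E) f = u (v f). Proof. by []. Qed.
Lemma endo_oneE (f : P) : (1 : E) f = f. Proof. by []. Qed.
Lemma endo_zeroE (f : P) : (0 : E) f = 0. Proof. by []. Qed.
Lemma mulopE (f g : P) : mulop f g = f * g. Proof. by []. Qed.

Lemma mulopM (f g : P) : mulop (f * g) = mulop f * mulop g.
Proof. by apply: endoP => h; rewrite endo_mulE !mulopE mulrA. Qed.

Lemma mulop1 : mulop (1 : P) = 1.
Proof. by apply: endoP => h; rewrite mulopE mul1r. Qed.

Lemma mulopX a m : mulop 'X_[a] 'X_[m] = 'X_[K, a + m].
Proof. by rewrite mulopE mpolyXD. Qed.

Lemma divpowX i k m :
  divpow K i k 'X_[m] = 'C(m i, k)%:R *: 'X_[m - U_(i) *+ k].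
Proof.
by rewrite [LHS]/(divpow_fun _ _ _) /divpow_fun msuppX big_seq1 mcoeffX eqxx mulr1.
Qed.

Lemma mdivpowX b m :
  mdivpow K b 'X_[m] = (\prod_(i < n) 'C(m i, b i))%:R *: 'X_[m - b].
Proof.
rewrite [X in 'X_[m - X]]multinomUE_id /mdivpow.
(* Induction over a duplicate-free list of indices: the tail does not contain [i], so it leaves the
   exponent of [i] unchanged. *)
elim: (index_enum _) (index_enum_uniq 'I_n) => [|i r IHr] /=.
  by rewrite !big_nil subm0 scale1r.
move=> /andP[i_r /IHr {}IHr].
rewrite !big_cons endo_mulE IHr endoZ divpowX scalerA -natrM mulnC.
congr ((_ * _)%:R *: 'X_[_]).
  rewrite mnmBE mnm_sumE big_seq big1 ?subn0 // => j j_r.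
  by rewrite mulmnE mnm1E; case: eqP j_r i_r => [->->|].
by rewrite submDA addmC.
Qed.

Definition monop a b : E := mulop 'X_[a] * mdivpow K b.

Lemma monopX a b m :
  monop a b 'X_[m] = (\prod_(i < n) 'C(m i, b i))%:R *: 'X_[a + (m - b)].
Proof. by rewrite endo_mulE mdivpowX endoZ mulopX. Qed.

Lemma monop0X i k : monop 0 (U_(i) *+ k) = divpow K i k.
Proof.
apply: endo_eq_monomial => m; rewrite monopX divpowX add0m.
rewrite (bigD1 i) //= big1 ?muln1; first by rewrite mulmnE mnm1E eqxx mul1n.
by move=> j ji; rewrite mulmnE mnm1E eq_sym (negbTE ji) bin0.
Qed.

(* Leibniz: d^[b] x_j = x_j d^[b] + d^[b - e_j]; the factor (0 < b j) is needed
   because b - e_j is truncated. *)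
Lemma monop_mulopU a b j : monop a b * mulop 'X_j =
  monop (a + U_(j)) b + (0 < b j)%:R *: monop a (b - U_(j)).
Proof.
apply: endo_eq_monomial => m.
rewrite endo_addE endo_scaleE endo_mulE mulopX !monopX.
have prodE b' : (forall i, i != j -> b' i = b i) ->
    \prod_(i < n) 'C(m i, b' i) =
    ('C(m j, b' j) * \prod_(i < n | i != j) 'C(m i, b i))%N.
  by move=> b'E; rewrite (bigD1 j) //=; congr (_ * _)%N; apply: eq_bigr => i /b'E->.
rewrite [X in X%:R *: 'X_[a + (_ + _ - _)]](_ : _ =
    'C((m j).+1, b j) * \prod_(i < n | i != j) 'C(m i, b i))%N; last first.
  rewrite (bigD1 j) //= mnmDE mnm1E eqxx; congr (_ * _)%N.
  by apply: eq_bigr => i ij; rewrite mnmDE mnm1E eq_sym (negbTE ij).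
rewrite (prodE b) // (prodE (b - U_(j))%MM); last first.
  by move=> i ij; rewrite mnmBE mnm1E eq_sym (negbTE ij) subn0.
rewrite mnmBE mnm1E eqxx subn1 scalerA -natrM.
set r := \prod_(_ < _ | _) _.
have [bj|bj] := posnP (b j).
  rewrite bj !bin0 mul0n scale0r addr0; congr (_ *: 'X_[_]).
  by apply/mnmP => i; rewrite !mnmE; case: eqP => [<-|_]; lia.
have {1}-> : (U_(j) + m - b = m - (b - U_(j)))%MM.
  by apply/mnmP => i; rewrite !mnmE; case: eqP => [<-|_]; lia.
(* Pascal's rule yields the two terms. When [m j < b j] the first coefficient vanishes, so its
   truncated exponent is harmless. *)
rewrite -(prednK bj) binS /= prednK // mul1n mulnDl natrD scalerDl.
congr (_ + _); have [mj|mj] := ltnP (m j) (b j); first by rewrite bin_small ?scale0r.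
congr (_ *: 'X_[_]).
by apply/mnmP => i; rewrite !mnmE; case: eqP => [<-|_]; lia.
Qed.

End MonomialAction.

(** * Orders of operators, and how filtration levels control degrees *)

Section Orders.
Context (K : fieldType) (n : nat).
Local Notation P := {mpoly K[n]}.
Local Notation E := (endo K n).
Implicit Types (a b c m : 'X_{1..n}) (u v : E) (f g : P).

Lemma mnm_ind (Q : 'X_{1..n} -> Prop) :
  Q 0%MM -> (forall i m, Q m -> Q (U_(i) + m)%MM) -> forall m, Q m.
Proof.
move=> Q0 QU m; rewrite [m]multinomUE_id; apply: big_rec => // i m' _ Qm'.
by elim: (m i) => [|k IHk]; rewrite ?mulm0n ?add0m // mulmS -addmA; exact: QU.
Qed.

Lemma diffop_le_mulop k f : diffop_le k (mulop f).
Proof.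
by apply: (@diffop_leW _ _ 0%N) => // g; rewrite -!mulopM mulrC subrr.
Qed.

(** The commutator with [u] is a derivation, [[u, fg] = [u, f] g + f [u, g]], and multiplications
    have order 0, so the bound passes from variables to monomials and, by linearity, to all
    polynomials. *)
Lemma diffop_leS_var k u :
    (forall j : 'I_n, diffop_le k (u * mulop 'X_j - mulop 'X_j * u)) ->
  diffop_le k.+1 u.
Proof.
move=> uX f.
have mulopD : forall (x : K) g h, mulop (x *: g + h) = x *: mulop g + mulop h.
  by move=> x g h; apply: endoP => e; rewrite endo_addE endo_scaleE !mulopE
    mulrDl scalerAl.
elim/mpolyind: f => [|x m f _ _ IHf].
  rewrite (_ : mulop 0 = 0); last by apply: endoP => e; rewrite mulopE mul0r.
  by rewrite mul0r mulr0 subrr; exact: diffop_le0.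
rewrite mulopD mulrDl mulrDr -scalerAl -scalerAr opprD addrACA -scalerBr.
apply: diffop_le_linear => //; elim/mnm_ind: m => [|j m IHm].
  by rewrite mpolyX0 mulop1 mul1r mulr1 subrr; exact: diffop_le0.
rewrite mpolyXD mulopM.
have -> : u * (mulop 'X_j * mulop 'X_[m]) - mulop 'X_j * mulop 'X_[m] * u =
    (u * mulop 'X_j - mulop 'X_j * u) * mulop 'X_[m] +
    mulop 'X_j * (u * mulop 'X_[m] - mulop 'X_[m] * u).
  by rewrite mulrBl mulrBr !mulrA addrA subrK.
apply: diffop_leD.
  by rewrite -[k]addn0; apply: diffop_leM => //; exact: diffop_le_mulop.
by rewrite -[k]add0n; apply: diffop_leM => //; exact: diffop_le_mulop.
Qed.

(** By the Leibniz rule, the commutator of [divpow K i k.+1] with ['X_j] is [divpow K i k] if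
    [j = i] and 0 otherwise. *)
Lemma diffop_le_divpow i k : diffop_le k (divpow K i k : E).
Proof.
elim: k => [|k IHk].
  rewrite (_ : divpow K i 0 = 1); first by move=> f; rewrite mul1r mulr1 subrr.
  by apply: endo_eq_monomial => m; rewrite divpowX bin0 scale1r mulm0n subm0.
apply: diffop_leS_var => j.
rewrite -monop0X monop_mulopU.
have -> : mulop 'X_j * monop K 0 (U_(i) *+ k.+1) =
    monop K (0 + U_(j)) (U_(i) *+ k.+1).
  by rewrite mulrA -mulopM -mpolyXD addm0 add0m.
rewrite addrAC subrr add0r mulmnE mnm1E muln_gt0 andbT lt0b.
case: eqP => [<-|_]; last by rewrite scale0r; exact: diffop_le0.
rewrite scale1r (_ : _ - _ = U_(i) *+ k)%MM ?monop0X //.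
by rewrite mulmS addmC addmK.
Qed.

Lemma monop_diffop a b : monop K a b \in @is_diffop K n.
Proof.
apply: rpredM; first by apply/asboolP; exists 0%N; exact: diffop_le_mulop.
by apply: rpred_prod => i _; apply/asboolP; exists (b i); exact: diffop_le_divpow.
Qed.

Lemma val_diffopP x (u v : diffop K n) : val (x *: u + v) = x *: val u + val v.
Proof. by []. Qed.

Lemma val_diffopZ x (u : diffop K n) : val (x *: u) = x *: val u.
Proof. by []. Qed.

Lemma val_diffopM (u v : diffop K n) : val (u * v) = val u * val v.
Proof. by []. Qed.

Definition monomials (k : nat) : set E :=
  [set monop K ab.1 ab.2 | ab in [set ab : 'X_{1..n} * 'X_{1..n} |
     (mdeg ab.1 + mdeg ab.2 <= k)%N]].

Lemma canonical_filtrationE k (u : diffop K n) :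
  canonical_filtration k u = lin_span (monomials k) (val u).
Proof. by []. Qed.

Lemma monop_monomials a b k :
  (mdeg a + mdeg b <= k)%N -> monomials k (monop K a b).
Proof. by move=> ab; exists (a, b). Qed.

Lemma monomials_ind k (Q : E -> Prop) : Q 0 ->
    (forall x a b v, (mdeg a + mdeg b <= k)%N -> Q v ->
      Q (x *: monop K a b + v)) ->
  forall u, lin_span (monomials k) u -> Q u.
Proof.
by move=> Q0 QS; apply: lin_span_ind => // x _ v [[a b] ab <-]; exact: QS.
Qed.

Lemma lin_span_diffop k u : lin_span (monomials k) u -> u \in @is_diffop K n.
Proof.
move: u; apply: monomials_ind => [|c a b v _ v_in]; first exact: rpred0.
by rewrite rpredD // rpredZ // monop_diffop.
Qed.

(** Moving one variable leftwards through a divided power by the Leibniz rule costs at most one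
    filtration level. *)
Lemma lin_span_mulopX k c u : lin_span (monomials k) u ->
  lin_span (monomials (k + mdeg c)) (u * mulop 'X_[c]).
Proof.
elim/mnm_ind: c k u => [|j c IHc] k u uk.
  by rewrite mpolyX0 mulop1 mulr1 mdeg0 addn0.
rewrite mpolyXD mulopM mulrA mdegD mdeg1 add1n addnS -addSn; apply: IHc.
move: u uk; apply: monomials_ind => [|x a b v ab vk].
  by rewrite mul0r; exact: lin_span0.
rewrite mulrDl -scalerAl monop_mulopU.
apply: lin_spanD vk; apply/lin_spanZ/lin_spanD; last apply: lin_spanZ.
  by apply/lin_span_incl/monop_monomials; rewrite mdegD mdeg1 addn1 addSn ltnS.
apply/lin_span_incl/monop_monomials.
by rewrite (leq_trans _ (leqW ab)) // leq_add2l mdegB.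
Qed.

Lemma lin_span_msupp k u m m' : lin_span (monomials k) u ->
  m' \in msupp (u 'X_[m]) -> (mdeg m' <= mdeg m + k)%N.
Proof.
move=> uk; apply: contraLR; rewrite -ltnNge -mcoeff_eq0 => lt_m'.
apply/eqP; move: u uk; apply: monomials_ind => [|x a b v ab vm'].
  by rewrite endo_zeroE mcoeff0.
rewrite endo_addE endo_scaleE mcoeffD vm' addr0 monopX !mcoeffZ mcoeffX.
case: eqP => [m'E|_]; last by rewrite !mulr0.
move: lt_m'; rewrite -m'E mdegD; have := mdegB m b; lia.
Qed.

(** [monop K a b] sends 1 to a multiple of ['X_[a]], whose exponent at [i] is at most [l], hence
    less than [k]. *)
Lemma divpow_lin_span i k l u :
  (l < k)%N -> lin_span (monomials l) u -> divpow K i k (u 1) = 0.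
Proof.
move=> lt_lk ul; rewrite -mpolyX0.
move: u ul; apply: monomials_ind => [|x a b v ab IHv].
  by rewrite endo_zeroE endo0.
rewrite endo_addE endo_scaleE endoD IHv addr0 monopX !endoZ divpowX
  bin_small ?scale0r ?scaler0 //.
rewrite !mnmE sub0n addn0 (leq_ltn_trans _ lt_lk) // (leq_trans _ ab) //.
by rewrite (leq_trans _ (leq_addr _ _)) // mdegE (bigD1 i) //= leq_addr.
Qed.

End Orders.

(** * The lower bound *)

Section LowerBound.
Context (K : fieldType) (n : nat) (i0 : 'I_n).
Local Notation D := (diffop K n).
Local Notation F := (@canonical_filtration K n).

(** This is the bound for [lambda_u], whose condition on [j] is the weakest of the four; the other
    three lower bounds follow from it. *)
Lemma unit_sandwich_ge i j :
    (forall a, F i a -> a <> 0 ->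
      units (A := D) `&` sandwich setT a (F j) !=set0) ->
  (i <= j)%N.
Proof.
move=> unit_in; rewrite leqNgt; apply/negP => lt_ji.
have d_in : divpow K i0 i \in @is_diffop K n by rewrite -monop0X monop_diffop.
pose d : D := Diffop d_in.
have Fd : F i d.
  rewrite canonical_filtrationE /= -monop0X.
  by apply/lin_span_incl/monop_monomials; rewrite mdeg0 mdegMn mdeg1 mul1n.
have d_neq0 : d <> 0.
  move=> d0; have dE : divpow K i0 i = 0.
    by rewrite -[LHS]/(val d) d0 raddf0.
  (* The [i]-th divided power sends the [i]-th power of the variable to 1, in any characteristic. *)
  have := divpowX K i0 i (U_(i0) *+ i).
  rewrite dE endo_zeroE mulmnE mnm1E eqxx mul1n binn scale1r.
  move=> /(congr1 (mcoeff (U_(i0) *+ i - U_(i0) *+ i)))/eqP; rewrite mcoeffX eqxx mcoeff0.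
  by rewrite eq_sym oner_eq0.
have [u [[v [_ vu1]] u_in]] := unit_in d Fd d_neq0.
have u1 : (val u : endo K n) 1 = 0.
  move: u u_in {vu1}; apply: lin_span_ind => [|c _ w [x _ [y Fy <-]] w1].
    by rewrite raddf0.
  rewrite val_diffopP !val_diffopM. rewrite endo_addE w1 addr0 endo_scaleE.
  rewrite !endo_mulE (divpow_lin_span i0 lt_ji Fy).
  by rewrite !endo0 scaler0.
have : (val (v * u) : endo K n) 1 = 1 by rewrite vu1.
rewrite val_diffopM endo_mulE u1 endo0 => /eqP.
by rewrite eq_sym oner_eq0.
Qed.

End LowerBound.

(** * Matrix units and the upper bound *)

Section MatrixUnits.
Context (K : fieldType) (n p : nat) (p_char : p \in [pchar K]).
Local Notation P := {mpoly K[n]}.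
Local Notation E := (endo K n).
Implicit Types (a b c d g m s : 'X_{1..n}) (u v : E).

Let p_pr : prime p. Proof. exact: pcharf_prime p_char. Qed.
Let q_gt0 k : (0 < p ^ k)%N. Proof. by rewrite expn_gt0 prime_gt0. Qed.

Lemma leq_mdeg m i : (m i <= mdeg m)%N.
Proof. by rewrite mdegE (bigD1 i) //= leq_addr. Qed.

Lemma mdeg_leq m N : (forall i, m i <= N)%N -> (mdeg m <= n * N)%N.
Proof.
move=> mN; rewrite mdegE (leq_trans (leq_sum _ (fun i _ => mN i))) //.
by rewrite sum_nat_const card_ord.
Qed.

Lemma monomialsS i j : (i <= j)%N -> @monomials K n i `<=` monomials j.
Proof.
by move=> ij _ [ab /= ab_i <-]; exists ab => //=; exact: leq_trans ij.
Qed.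

(** Linearity over the [p ^ k]-th powers of the variables: all entries of [b] are below [p ^ k], so
    the binomials do not see [s *+ p ^ k]. *)
Lemma lin_span_pfactor i k u s d :
    lin_span (monomials i) u -> (i < p ^ k)%N ->
  u 'X_[s *+ p ^ k + d] = 'X_[s *+ p ^ k] * u 'X_[d].
Proof.
move=> ui lt_iq; move: u ui; apply: monomials_ind => [|x a b v ab vX].
  by rewrite endo_zeroE mulr0.
rewrite !endo_addE !endo_scaleE mulrDr vX -scalerAr !monopX; congr (_ *: _ + _).
rewrite -scalerAr -mpolyXD !natr_prod.
rewrite (eq_bigr (fun j => 'C(d j, b j)%:R)) => [|j _]; last first.
  rewrite mnmDE mulmnE bin_addl_pfactor // (leq_ltn_trans _ lt_iq) //.
  by rewrite (leq_trans (leq_mdeg b j)) // (leq_trans _ ab) // leq_addl.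
(* If some [b j > d j], both coefficients vanish; otherwise no subtraction of exponents is
   truncated. *)
have [/forallP bd|] := boolP [forall j, b j <= d j]%N; last first.
  rewrite negb_forall => /existsP[j]; rewrite -ltnNge => lt_db.
  by rewrite (bigD1 j) //= bin_small // mul0r !scale0r.
congr (_ *: 'X_[_]); by apply/mnmP => j; have := bd j; rewrite !mnmE; lia.
Qed.

Section Level.
Variable k : nat.
Local Notation q := (p ^ k)%N.
Let Q : 'X_{1..n} := [multinom q.-1 | i < n].

(* The matrix unit of End_{K[x^q]}(P_n) for the basis of monomials of exponents
   less than q; in one variable it is x^a d^[q-1] x^(q-1-c), because
   C(t, q - 1) = 1 in K when q divides t + 1, and 0 otherwise. *)
Definition mxunit a c : E := monop K a Q * mulop 'X_[Q - c].

Lemma mxunitX a c m : (forall i, c i < q)%N ->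
  mxunit a c 'X_[m] =
  if [forall i, m i == c i %[mod q]] then 'X_[a + (m - c)] else 0.
Proof.
move=> lt_cq; rewrite endo_mulE mulopX monopX natr_prod.
have -> : (a + (Q - c + m - Q) = a + (m - c))%MM.
  by apply/mnmP => i; rewrite !mnmE; have := lt_cq i; lia.
rewrite (eq_bigr (fun i => (m i == c i %[mod q])%:R)) => [|i _]; last first.
  rewrite mnmDE mnmBE mnmE bin_pred_pfactor //; congr (nat_of_bool _)%:R.
  rewrite (_ : _.+1 = (m i + (q - c i))%N); last by have := lt_cq i; lia.
  by rewrite /dvdn -(eqn_modDr (q - c i)) subnKC ?(ltnW (lt_cq i)) // modnn.
case: forallP => [mc|/forallP].
  by rewrite big1 ?scale1r // => i _; rewrite mc.
rewrite negb_forall => /existsP[i /negbTE mc].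
by rewrite (bigD1 i) //= mc mul0r scale0r.
Qed.

(** The three exponents [a], [Q] and [Q - c] each have degree at most [n * q]. *)
Lemma mxunit_lin_span a c : (forall i, a i < q)%N ->
  lin_span (monomials (3 * n * q)) (mxunit a c).
Proof.
move=> lt_aq; have Qq : (mdeg Q <= n * q)%N.
  by apply: mdeg_leq => i; rewrite mnmE leq_pred.
have aq : (mdeg a <= n * q)%N by apply: mdeg_leq => i; exact: ltnW.
apply: sub_lin_span (monomialsS _) _ _; last first.
  exact/lin_span_mulopX/lin_span_incl/monop_monomials/leqnn.
rewrite -mulnA; move: (mdegB Q c) Qq aq; set N := (n * q)%N; lia.
Qed.

Definition mnm_of_ffun (al : {ffun 'I_n -> 'I_q}) : 'X_{1..n} :=
  [multinom (al i : nat) | i < n].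

Lemma mnm_of_ffun_lt al i : (mnm_of_ffun al i < q)%N.
Proof. by rewrite mnmE. Qed.

(** On monomials of residue [al] modulo [q], the right unit replaces [al] by [d], [u] acts over the
    [q]-th powers, and the left unit extracts the coefficient at [g] and restores [al]. On other
    residues the term is zero, so the sum over all residues is a scalar. *)
Lemma mxunit_sandwich i u d g :
    lin_span (monomials i) u -> (i < q)%N ->
    (forall j, d j < q)%N ->
    (forall m, m \in msupp (u 'X_[d]) -> forall j, m j < q)%N ->
    g \in msupp (u 'X_[d]) ->
  \sum_al mxunit (mnm_of_ffun al) g * u * mxunit d (mnm_of_ffun al) =
  (u 'X_[d])@_g *: 1.
Proof.
move=> ui lt_iq lt_dq lt_fq gf; have lt_gq := lt_fq g gf.
apply: endo_eq_monomial => m; rewrite endo_scaleE endo_oneE.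
have -> (I : finType) (G : I -> E) (f : P) : (\sum_i G i : E) f = \sum_i G i f.
  elim/big_rec2: _ => [|j v w _ <-]; first exact: endo_zeroE.
  by rewrite endo_addE.
pose m0 : {ffun 'I_n -> 'I_q} := [ffun j => Ordinal (ltn_pmod (m j) (q_gt0 k))].
pose term al : E := mxunit (mnm_of_ffun al) g * u * mxunit d (mnm_of_ffun al).
have off_diag al : al != m0 -> term al 'X_[m] = 0.
  move=> ne_al; rewrite /term 2!endo_mulE (mxunitX d) //; last exact: mnm_of_ffun_lt.
  case: forallP => [mal|_]; last by rewrite !endo0.
  case/eqP: ne_al; apply/ffunP => j; apply: val_inj; rewrite ffunE /=.
  by move/eqP: (mal j); rewrite mnmE (modn_small (ltn_ord _)) => ->.
suff diag : term m0 'X_[m] = (u 'X_[d])@_g *: 'X_[m].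
  rewrite (bigD1 m0) //= [X in _ + X]big1 ?addr0; first exact: diag.
  exact: off_diag.
rewrite /term 2!endo_mulE (mxunitX d) //; last exact: mnm_of_ffun_lt.
have -> : [forall j, m j == mnm_of_ffun m0 j %[mod q]].
  by apply/forallP => j; rewrite mnmE ffunE /= modn_mod.
pose s := [multinom (m j %/ q)%N | j < n].
have -> : (d + (m - mnm_of_ffun m0) = s *+ q + d)%MM.
  apply/mnmP => j; rewrite mnmDE mnmBE mnmDE mulmnE !mnmE ffunE /= addnC.
  by rewrite {1}(divn_eq (m j) q) addnK.
rewrite (lin_span_pfactor _ _ ui lt_iq) [in LHS](mpolyE (u 'X_[d])).
rewrite mulr_sumr endo_sum big_seq.
(* All exponents of [u 'X_[d]] are below [q], so congruence to [g] modulo [q] means equality with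
   [g]. *)
have coefE m' : m' \in msupp (u 'X_[d]) ->
    mxunit (mnm_of_ffun m0) g ('X_[s *+ q] * ((u 'X_[d])@_m' *: 'X_[m'])) =
    if m' == g then (u 'X_[d])@_g *: 'X_[m] else 0.
  move=> m'f; rewrite -scalerAr endoZ -mpolyXD mxunitX //.
  have [->|ne_m'] := eqVneq m' g; last first.
    case: forallP => [m'g|_]; last by rewrite scaler0.
    case/eqP: ne_m'; apply/mnmP => j; move/eqP: (m'g j).
    by rewrite mnmDE mulmnE modnMDl !modn_small // lt_fq.
  have -> : [forall j, (s *+ q + g)%MM j == g j %[mod q]].
    by apply/forallP => j; rewrite mnmDE mulmnE modnMDl.
  congr (_ *: 'X_[_]); apply/mnmP => j.
  by rewrite mnmDE mnmBE mnmDE mulmnE !mnmE ffunE /= addnK addnC -divn_eq.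
rewrite (eq_bigr _ coefE) -big_seq (bigD1_seq g) ?msupp_uniq //= eqxx.
by rewrite big1 ?addr0 // => m' /negbTE->.
Qed.

End Level.

Lemma sandwich_one i (a : diffop K n) : (0 < i)%N ->
    canonical_filtration i a -> a <> 0 ->
  let j := (3 * n * p ^ n.+2 * i)%N in
  sandwich (@canonical_filtration K n j) a (@canonical_filtration K n j) 1.
Proof.
move=> i_gt0; rewrite canonical_filtrationE; set u : E := val a => ui a_neq0 j.
have p_gt1 := prime_gt1 p_pr.
(* [q0] is the least power of [p] above [i], so [q0 <= p * i]; with the factor [p ^ n.+1] in [p ^ k]
   this gives the [p ^ n.+2] in [j]. *)
pose k0 := (trunc_log p i).+1; pose q0 := (p ^ k0)%N.
have lt_iq0 : (i < q0)%N by exact: trunc_log_ltn.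
have le_q0 : (q0 <= p * i)%N by rewrite /q0 expnS leq_mul2l trunc_logP ?orbT.
pose k := (n.+1 + k0)%N; have qE : (p ^ k = p ^ n.+1 * q0)%N by rewrite expnD.
(* The left side will bound the degree of [u 'X_[d]], so that its exponents lie below [p ^ k]. *)
have lt_q : (n * q0 + i < p ^ k)%N.
  rewrite qE; apply: (@leq_trans (n.+1 * q0)); first by rewrite mulSnr ltn_add2l.
  by rewrite leq_mul2r ltnW ?orbT // ltn_expl.
have lt_iq : (i < p ^ k)%N by apply: leq_ltn_trans lt_q; rewrite leq_addl.
have [m um] : exists m, u 'X_[m] != 0.
  apply: contra_notP a_neq0 => u0; apply/val_inj/endo_eq_monomial => m.
  by apply/eqP/negPn/negP => um; apply: u0; exists m.
(* By linearity over the [q0]-th powers, reducing the exponents of [m] modulo [q0] keeps the image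
   under [u] nonzero. *)
pose d := [multinom (m l %% q0)%N | l < n].
have dq0 l : (d l < q0)%N by rewrite mnmE; exact: ltn_pmod (q_gt0 k0).
have ud : u 'X_[d] != 0.
  apply: contraNneq um => ud.
  have -> : (m = [multinom (m l %/ q0)%N | l < n] *+ q0 + d)%MM.
    by apply/mnmP => l; rewrite mnmDE mulmnE !mnmE -divn_eq.
  by rewrite (lin_span_pfactor _ _ ui lt_iq0) ud mulr0.
have le_d : (mdeg d <= n * q0)%N by apply: mdeg_leq => l; exact: ltnW.
have lt_f m' : m' \in msupp (u 'X_[d]) -> forall l, (m' l < p ^ k)%N.
  move=> /(lin_span_msupp ui) le_m' l.
  rewrite (leq_ltn_trans (leq_mdeg m' l)) // (leq_ltn_trans le_m') //.
  by apply: leq_ltn_trans lt_q; rewrite leq_add2r.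
have [g gf] : exists g, g \in msupp (u 'X_[d]).
  case Ef: (msupp (u 'X_[d])) => [|g r]; last by exists g; rewrite mem_head.
  by move: ud; rewrite -msupp_eq0 Ef.
have d_lt l : (d l < p ^ k)%N.
  by rewrite (leq_trans (dq0 l)) // qE leq_pmull ?expn_gt0 ?prime_gt0.
have le_j : (3 * n * p ^ k <= j)%N.
  by rewrite qE /j (expnSr p n.+1) -!mulnA !leq_mul2l le_q0 !orbT.
have mxunit_in b c (bq : forall l, (b l < p ^ k)%N) :
    lin_span (monomials j) (mxunit k b c).
  exact: sub_lin_span (monomialsS le_j) _ (mxunit_lin_span _ bq).
pose L al : diffop K n :=
  Diffop (lin_span_diffop (mxunit_in _ g (@mnm_of_ffun_lt k al))).
pose T (al : {ffun 'I_n -> 'I_(p ^ k)}) : diffop K n :=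
  Diffop (lin_span_diffop (mxunit_in d (mnm_of_ffun al) d_lt)).
have -> : 1 = ((u 'X_[d])@_g)^-1 *: \sum_al L al * a * T al.
  apply: val_inj.
  have := mxunit_sandwich ui lt_iq d_lt lt_f gf.
  move=> /(congr1 (fun v => ((u 'X_[d])@_g)^-1 *: v)).
  rewrite scalerA mulVf -?mcoeff_msupp // scale1r => oneE.
  rewrite [LHS](_ : _ = 1 :> E) // -oneE.
  rewrite [RHS]val_diffopZ; congr (_ *: _); rewrite [RHS]raddf_sum.
  by apply: eq_bigr.
apply: lin_spanZ; apply: lin_span_sum => al; apply: lin_span_incl.
exists (L al); first exact: mxunit_in _ (@mnm_of_ffun_lt k al).
by exists (T al) => //; exact: mxunit_in d_lt.
Qed.

End MatrixUnits.

Unset Implicit Arguments.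

Theorem theorem4p2 (R : realType) (K : fieldType) (p n : nat)
    (hp : p \in [pchar K]) (hn : (1 <= n)%N) :
  [/\ fd R (@canonical_filtration K n) = 1%:E,
      lfd R (@canonical_filtration K n) = 1%:E,
      ud R (@canonical_filtration K n) = 1%:E
    & lud R (@canonical_filtration K n) = 1%:E].
Proof.
set F := @canonical_filtration K n; set D : algType K := diffop K n.
pose C := (3 * n * p ^ n.+2)%N.
have upper i : (0 < i)%N ->
    forall a, F i a -> a <> 0 -> sandwich (F (C * i)%N) a (F (C * i)%N) 1.
  by move=> i_gt0 a Fa a0; exact: (sandwich_one hp i_gt0 Fa a0).
have lower := @unit_sandwich_ge K n (Ordinal hn).
have sandwichT (X Y : set D) a : sandwich X a Y `<=` sandwich setT a Y.
  by apply: sub_lin_span => _ [x _ [y Yy <-]]; exists x => //; exists y.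
have unit1 : units (A := D) 1 by exists 1; rewrite mulr1.
(* For each function, the upper bound comes from [upper], enlarging the left factor or viewing 1 as
   a unit; the lower bound is reduced to [lower] in the same way. *)
split; apply: (@growth_min_nat R C) => [i i_gt0 /= a Fa a0|i j unit_in].
- exact: upper.
- by apply: lower => a Fa a0; exists 1; split=> //; exact/sandwichT/unit_in.
- exact/sandwichT/upper.
- by apply: lower => a Fa a0; exists 1; split=> //; exact: unit_in.
- by exists 1; split=> //; exact: upper.
- apply: lower => a Fa a0; have [w [uw ww]] := unit_in a Fa a0.
  by exists w; split=> //; exact: sandwichT ww.
- by exists 1; split=> //; exact/sandwichT/upper.
- exact: lower unit_in.
Qed.
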